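(* Let $(L,\ast,\delta)$ be an InvDer pre-Lie algebra over $\mathbb{K}$. Then $(L,[\cdot,\cdot]_C,\delta)$ is an InvDer-Lie algebra, where $[x,y]_C=x\ast y-y\ast x$ for all $x,y\in L$.
   Context: $\mathbb{K}$ is a field of characteristic $0$. A derivation of an algebra $(L,\mu)$ is a linear map $d:L\to L$ with $d(\mu(x,y))=\mu(dx,y)+\mu(x,dy)$ for all $x,y$. $\mathrm{InvDer}(L)$ denotes the set of invertible derivations $\delta$ of the algebra $L$ such that $\delta^{-1}$ is also a derivation. A pre-Lie algebra is a vector space $L$ with a bilinear product $\ast$ such that $x\ast(y\ast z)-(x\ast y)\ast z=y\ast(x\ast z)-(y\ast x)\ast z$ for all $x,y,z\in L$. An InvDer pre-Lie algebra $(L,\ast,\delta)$ is a pre-Lie algebra $(L,\ast)$ equipped with $\delta\in\mathrm{InvDer}(L)$ satisfying $\delta x\ast(y\ast z)-(x\ast y)\ast\delta z=\delta y\ast(x\ast z)-(y\ast x)\ast\delta z$ for all $x,y,z\in L$. An InvDer-Lie algebra $(L,[\cdot,\cdot],\delta)$ is a Lie algebra $(L,[\cdot,\cdot])$ equipped with $\delta\in\mathrm{InvDer}(L)$ satisfying $[\delta x,[y,z]]+[\delta y,[z,x]]+[\delta z,[x,y]]=0$ for all $x,y,z\in L$. *)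

(* Defs.v *)
From mathcomp Require Import all_boot all_algebra.

Set Implicit Arguments.
Unset Strict Implicit.
Unset Printing Implicit Defensive.

Import GRing.Theory.
Local Open Scope ring_scope.

Definition derivation (K : fieldType) (L : lmodType K) (mu : L -> L -> L)
    (d : L -> L) : Prop :=
  linear d /\ forall x y, d (mu x y) = mu (d x) y + mu x (d y).

Definition InvDer (K : fieldType) (L : lmodType K) (mu : L -> L -> L)
    (delta : L -> L) : Prop :=
  derivation mu delta /\
  exists deltaV : L -> L,
    [/\ cancel delta deltaV, cancel deltaV delta & derivation mu deltaV].

Definition pre_Lie (K : fieldType) (L : lmodType K) (mu : L -> L -> L) : Prop :=
  bilinear_for *:%R *:%R mu /\
  forall x y z,
    mu x (mu y z) - mu (mu x y) z = mu y (mu x z) - mu (mu y x) z.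

Definition Lie (K : fieldType) (L : lmodType K) (br : L -> L -> L) : Prop :=
  [/\ bilinear_for *:%R *:%R br,
      forall x, br x x = 0
    & forall x y z, br x (br y z) + br y (br z x) + br z (br x y) = 0].

Definition InvDer_pre_Lie (K : fieldType) (L : lmodType K)
    (mu : L -> L -> L) (delta : L -> L) : Prop :=
  [/\ pre_Lie mu, InvDer mu delta
    & forall x y z,
        mu (delta x) (mu y z) - mu (mu x y) (delta z) =
        mu (delta y) (mu x z) - mu (mu y x) (delta z)].

Definition InvDer_Lie (K : fieldType) (L : lmodType K)
    (br : L -> L -> L) (delta : L -> L) : Prop :=
  [/\ Lie br, InvDer br delta
    & forall x y z,
        br (delta x) (br y z) + br (delta y) (br z x)
          + br (delta z) (br x y) = 0].

Definition commutator (K : fieldType) (L : lmodType K) (mu : L -> L -> L)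
    (x y : L) : L :=
  mu x y - mu y x.

(* Main.v *)
Require Import Defs.
From mathcomp Require Import all_boot all_algebra.

(** Both the Jacobi identity and its twisted form come from one computation.
    For a map [f], put [A x y z = mu (f x) (mu y z) - mu (mu x y) (f z)], an
    associator twisted by [f]. Expanding the commutators, the cyclic sum of
    [[f x, [y, z]]] is the cyclic sum of [A x y z - A y x z]: the twelve terms
    of the first sum are those of the second in another order. So it vanishes
    as soon as [A] is symmetric in its first two arguments
    ([twisted_jacobi_commutator]). The pre-Lie identity is this symmetry for
    [f = id], and the compatibility condition is this symmetry for
    [f = delta]. Finally, a derivation of a product is a derivation of its
    commutator; applied to [delta] and to its inverse, this gives the
    invertibility condition ([InvDer_commutator]). *)

Import GRing.Theory.
Local Open Scope ring_scope.

Lemma bilinear_commutator (K : fieldType) (L : lmodType K) (mu : L -> L -> L) :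
  bilinear_for *:%R *:%R mu -> bilinear_for *:%R *:%R (commutator mu).
Proof.
move=> [linl linr]; split=> u a x y; rewrite /commutator.
  by rewrite (linl u) (linr u) opprD addrACA -scalerBr.
by rewrite (linl u) (linr u) opprD addrACA -scalerBr.
Qed.

Lemma derivation_commutator (K : fieldType) (L : lmodType K) (mu : L -> L -> L)
    (d : L -> L) :
  derivation mu d -> derivation (commutator mu) d.
Proof.
move=> [lin_d der_d]; split=> // x y; rewrite /commutator.
have dB u v : d (u - v) = d u - d v.
  by rewrite [u - v]addrC -scaleN1r lin_d scaleN1r addrC.
by rewrite dB !der_d [mu (d y) x + _]addrC opprD addrACA.
Qed.

Lemma InvDer_commutator (K : fieldType) (L : lmodType K) (mu : L -> L -> L)
    (delta : L -> L) :
  InvDer mu delta -> InvDer (commutator mu) delta.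
Proof.
move=> [der_d [deltaV [dK dVK der_dV]]]; split; last exists deltaV.
  exact: derivation_commutator.
by split=> //; apply: derivation_commutator.
Qed.

(** The map [f] is arbitrary so that one proof serves twice: [f = id] gives the
    Jacobi identity and [f = delta] its twisted form. It vanishes because it is a sum of
    three differences of twisted associators, each zero by symmetry. *)
Lemma twisted_jacobi_commutator (K : fieldType) (L : lmodType K) (mu : L -> L -> L)
    (f : L -> L) :
  bilinear_for *:%R *:%R mu ->
  (forall x y z,
     mu (f x) (mu y z) - mu (mu x y) (f z) =
     mu (f y) (mu x z) - mu (mu y x) (f z)) ->
  forall x y z,
    commutator mu (f x) (commutator mu y z)
      + commutator mu (f y) (commutator mu z x)
      + commutator mu (f z) (commutator mu x y) = 0.
Proof.
move=> [linl linr] symA x y z.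
have muBl u v w : mu (u - v) w = mu u w - mu v w.
  by rewrite [u - v]addrC -scaleN1r (linl w) /= scaleN1r addrC.
have muBr u v w : mu w (u - v) = mu w u - mu w v.
  by rewrite [u - v]addrC -scaleN1r (linr w) /= scaleN1r addrC.
pose A u v w := mu (f u) (mu v w) - mu (mu u v) (f w).
have A0 u v w : A u v w - A v u w = 0 by rewrite /A symA subrr.
suff -> : commutator mu (f x) (commutator mu y z)
      + commutator mu (f y) (commutator mu z x)
      + commutator mu (f z) (commutator mu x y)
    = (A x y z - A y x z) + (A y z x - A z y x) + (A z x y - A x z y).
  by rewrite !A0 !addr0.
rewrite /A /commutator !muBl !muBr !opprB !addrA.
(* The pattern gives, for each of the twelve terms on the left, its position
   on the right. *)
by rewrite [RHS](ACl (1*12*7*6*5*4*11*10*9*8*3*2)).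
Qed.

Theorem proposition3p1 (K : fieldType) (charK0 : [pchar K] =i pred0)
    (L : lmodType K) (mu : L -> L -> L) (delta : L -> L) :
  InvDer_pre_Lie mu delta -> InvDer_Lie (commutator mu) delta.
Proof.
move=> [[bil_mu preLie] invder twisted]; split.
- split; first exact: bilinear_commutator.
  + by move=> x; rewrite /commutator subrr.
  + exact: (@twisted_jacobi_commutator _ _ _ id).
- exact: InvDer_commutator.
- exact: twisted_jacobi_commutator.
Qed.
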